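(* Let $B$ be a bouquet with $n$ edges which contains exactly one non-orientable loop. Then the number $\kappa(B)$ of spanning quasi-trees of $B$ equals $\det(I_n+A(B))$, where $A(B)$ is the intersection matrix of $B$ (for any choice of the orientations of chords used to define it).
   Context: A ribbon graph is a surface with boundary made of vertex discs and edge ribbons; a bouquet is a ribbon graph with exactly one vertex, so all edges are loops. A loop is non-orientable if together with the vertex it forms a Möbius band, and orientable otherwise. A quasi-tree is a ribbon graph with exactly one boundary component; $\kappa(B)$ is the number of $F\subseteq E(B)$ such that the spanning ribbon subgraph $(V(B),F)$ (delete edges outside $F$) is a quasi-tree. Framed chord diagram of $B$: take the boundary of the vertex as a circle; each edge $i$ gives a chord joining the two points where the ends of edge $i$ meet the circle; the chord has framing $1$ if the loop is non-orientable and $0$ otherwise. Intersection matrix $A(B)$ (rows/columns indexed by the edges $1,\dots,n$): choose an ordering $(a_i,b_i)$ of the endpoints of each chord $i$. Then $A_{i,i}$ is the framing of chord $i$; for $i<j$, $A_{i,j}=1$ if the endpoints appear in cyclic order $a_i,a_j,b_i,b_j$, $A_{i,j}=-1$ if they appear in cyclic order $a_i,b_j,b_i,a_j$, and $A_{i,j}=0$ otherwise (chords not interlaced); for $j<i$, $A_{i,j}=-A_{j,i}$. *)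

(* Defs.v *)
From mathcomp Require Import all_boot all_order all_fingroup all_algebra.

Set Implicit Arguments.
Unset Strict Implicit.
Unset Printing Implicit Defensive.

Import GRing.Theory.
Local Open Scope ring_scope.

(** A ribbon graph with vertex discs [V] and edge ribbons [E], given by its
    signed rotation system. Every vertex disc is oriented; the two ends of the
    ribbon [e] are the half-edges [(e, false)] and [(e, true)].
    [rot h] is the half-edge that follows [h] on the boundary of its vertex, so
    the half-edges at a vertex form one cycle of [rot]. [twist e] says that the
    ribbon [e] does not respect the orientations of the discs at its ends.
    A vertex outside the codomain of [att] is isolated. *)
Record ribbon_graph (V E : finType) := RibbonGraph {
  rot : {perm E * bool};
  att : E * bool -> V;
  twist : E -> bool;
  attP : forall h k, (att h == att k) = fconnect rot h k
}.

Definition bouquet (V E : finType) (G : ribbon_graph V E) : bool :=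
  #|V| == 1%N.

Section RibbonGraph.
Variables (V E : finType) (G : ribbon_graph V E).
Implicit Types (e : E) (h : E * bool) (F : {set E}).

Definition loop e := att G (e, false) == att G (e, true).

(** The disc at the end of a loop together with the ribbon is a Moebius band if
    the ribbon is twisted, and an annulus otherwise. *)
Definition nonorientable_loop e := loop e && twist G e.

(** Each half-edge [h] meets the boundary of its vertex in an arc, whose first
    and last points, along the orientation of the vertex, are the flags
    [(h, false)] and [(h, true)]. *)
Definition flag : finType := ((E * bool) * bool)%type.

(** The other end of the vertex arc between two consecutive half-edges. *)
Definition across_gap (x : flag) : flag :=
  let: (h, s) := x in
  if s then (rot G h, false) else ((rot G)^-1%g h, true).

(** In the spanning ribbon subgraph [(V, F)], if [e] is in [F] then the boundary
    follows a side of the ribbon [e]. If [e] is deleted then the boundary follows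
    the vertex arc to which the end of [e] was attached. *)
Definition across_edge F (x : flag) : flag :=
  let: ((e, b), s) := x in
  if e \in F then ((e, ~~ b), if twist G e then s else ~~ s)
  else ((e, b), ~~ s).

Definition boundary_adj F : rel flag :=
  [rel x y | (y == across_gap x) || (y == across_edge F x)].

Lemma across_gapK : involutive across_gap.
Proof. by case=> h [] /=; rewrite ?permK ?permKV. Qed.

Lemma across_edgeK F : involutive (across_edge F).
Proof.
case=> -[e b] s /=; case: ifP => /= ->; rewrite ?negbK //.
by case: twist; rewrite ?negbK.
Qed.

Lemma boundary_adj_sym F : symmetric (boundary_adj F).
Proof.
move=> x y /=; congr orb; rewrite eq_sym.
  exact: (can2_eq across_gapK across_gapK).
exact: (can2_eq (across_edgeK F) (across_edgeK F)).
Qed.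

(** The boundary of a vertex without half-edges carries no flag, so it is
    counted separately. *)
Definition nb_boundary F : nat :=
  (n_comp (boundary_adj F) predT + #|[pred v | v \notin codom (att G)]|)%N.

Definition spanning_quasi_tree F := nb_boundary F == 1%N.

Definition kappa : nat := #|[set F : {set E} | spanning_quasi_tree F]|.

(** The half-edges [x], [y], [z], [t] are distinct and are met in this order
    when one goes once around the boundary of a vertex. *)
Definition cyclic_order (x y z t : E * bool) : bool :=
  [&& fconnect (rot G) x y, fconnect (rot G) x z, fconnect (rot G) x t
    & sorted ltn [:: 0%N; findex (rot G) x y; findex (rot G) x z;
                          findex (rot G) x t]].

End RibbonGraph.

Section IntersectionMatrix.
Variables (V : finType) (n : nat) (B : ribbon_graph V 'I_n).

(** [o] chooses, for each chord [i], which of its two endpoints is [a_i]. *)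
Variable o : 'I_n -> bool.

Definition chord_a (i : 'I_n) : 'I_n * bool := (i, o i).
Definition chord_b (i : 'I_n) : 'I_n * bool := (i, ~~ o i).

Definition chord_sign (i j : 'I_n) : int :=
  if cyclic_order B (chord_a i) (chord_a j) (chord_b i) (chord_b j) then 1
  else if cyclic_order B (chord_a i) (chord_b j) (chord_b i) (chord_a j) then -1
  else 0.

Definition intersection_mx : 'M[int]_n :=
  \matrix_(i, j)
    if i == j then (nonorientable_loop B i)%:R
    else if (i < j)%N then chord_sign i j
    else - chord_sign j i.

End IntersectionMatrix.

(* Main.v *)
Require Import Defs.
From mathcomp Require Import all_boot all_order all_fingroup all_algebra.
From mathcomp Require Import ring zify.

(** [det (I + A)] is the sum over [F] of the principal minors [det A[F]], so it
    is enough that [det A[F]] is [1] if [F] is a quasi-tree and [0] otherwise.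

    Number the [2n] half-edges along the circle. Let [D] be the difference
    operator between consecutive gaps, [U] the invertible matrix obtained by
    cutting [D] open at one place, and [w_i = e_(a_i) - e_(b_i)]. Then
    [det A[F] = det (U - \sum_(i in F) w_i (w_i^T + tau_i D_(b_i)))], where
    [tau_i] is the framing, because of [det (1 - X Y) = det (1 - Y X)].
    - Modulo 2, this large matrix is the incidence matrix of the gaps and the
      ribbon sides of [(V, F)], corrected by a rank one term. Its kernel vanishes
      if and only if the boundary is connected. Hence [det A[F]] is odd if and
      only if [F] is a quasi-tree.
    - Over the integers and without framing, the large matrix is, up to a
      permutation matrix, [1 - P + e_x e_y^T] with [P] a permutation matrix.
      Its determinant is [1] or [0], according to whether [P] is a single cycle,
      and by parity [P] can be a single cycle for at most one of [F] and
      [F - e].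
    - If [e] is the only non-orientable loop and [e] is in [F], then
      [det A[F] = det S[F] + det S[F - e]] with [S] the skew part of [A]. Hence
      [det A[F]] is always [0] or [1]. *)

Set Implicit Arguments.
Unset Strict Implicit.
Unset Printing Implicit Defensive.

Import GRing.Theory.
Local Open Scope ring_scope.

(** * Determinant identities and permutation matrices with a rank one correction *)

Lemma sum_pred1_mul (R : pzSemiRingType) (I : finType) (k : I) (v : I -> R) :
  \sum_j (j == k)%:R * v j = v k.
Proof.
by rewrite (bigD1 k) //= eqxx mul1r big1 ?addr0 // => j /negbTE ->; rewrite mul0r.
Qed.

Lemma det_1Bmulmx_comm (R : comNzRingType) (m n : nat)
    (X : 'M[R]_(m, n)) (Y : 'M[R]_(n, m)) :
  \det (1%:M - X *m Y) = \det (1%:M - Y *m X).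
Proof.
have eqB : block_mx 1%:M 0 X 1%:M *m block_mx 1%:M Y 0 (1%:M - X *m Y) =
           block_mx (1%:M - Y *m X) Y 0 1%:M *m block_mx 1%:M 0 X 1%:M.
  rewrite !mulmx_block !mul1mx !mulmx1 !mulmx0 !mul0mx !addr0 !add0r.
  by rewrite addrC !subrK.
move/(congr1 determinant): eqB.
by rewrite !det_mulmx !det_lblock !det_ublock !det1 !mul1r !mulr1.
Qed.

(** Its determinant is the principal minor of [A] on [F]. *)
Definition principal_mx (R : comNzRingType) (n : nat) (F : {set 'I_n})
    (A : 'M[R]_n) : 'M[R]_n :=
  \matrix_(i, j) (if i \in F then A i j else (i == j)%:R).

(** In each factor of the Leibniz expansion, one chooses between the entry of [A] and that of the
    identity; [F] records the choices of [A]. *)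
Lemma det_1Dmx (R : comNzRingType) (n : nat) (A : 'M[R]_n) :
  \det (1%:M + A) = \sum_(F : {set 'I_n}) \det (principal_mx F A).
Proof.
rewrite exchange_big /=; apply: eq_bigr => s _.
rewrite -big_distrr /=; congr (_ * _).
under eq_bigr do rewrite !mxE addrC.
by rewrite bigA_distr; apply: eq_bigr => F _; apply: eq_bigr => i _; rewrite mxE.
Qed.

Lemma det_eq0_ker (R : idomainType) (n : nat) (A : 'M[R]_n) (v : 'I_n -> R) k :
  v k != 0 -> (forall i, \sum_j A i j * v j = 0) -> \det A = 0.
Proof.
move=> vk Av; apply/eqP; rewrite -det_tr; apply/det0P; exists (\row_j v j).
  by apply: contra vk => /eqP/rowP/(_ k); rewrite !mxE => ->.
apply/rowP => i; rewrite !mxE -[RHS](Av i); apply: eq_bigr => j _.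
by rewrite !mxE mulrC.
Qed.

Lemma det_1Bperm_notin (R : idomainType) (n : nat) (s : 'S_n) (x y z : 'I_n) :
  z \notin porbit s y -> \det (1%:M - perm_mx s + delta_mx x y) = 0 :> R.
Proof.
(* The indicator of the cycle of [z] is constant along [s] and vanishes at [y], so it lies in the
   kernel. *)
move=> zNy; pose v k : R := (k \in porbit s z)%:R.
apply: (@det_eq0_ker _ _ _ v z); first by rewrite /v porbit_id oner_neq0.
move=> i; rewrite (eq_bigr (fun j => (j == i)%:R * v j - (j == s i)%:R * v j
    + (j == y)%:R * ((i == x)%:R * v j))); last first.
  move=> j _; rewrite !mxE mulrDl mulrBl (eq_sym i) (eq_sym (s i)).
  by case: (j == y); rewrite ?andbT ?andbF ?mul1r ?mul0r.
rewrite big_split sumrB /= !sum_pred1_mul /v.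
rewrite [y \in _]porbit_sym (negbTE zNy) mulr0 addr0.
by rewrite -(porbit_sym s z (s i)) -(porbit_sym s z i) -!eq_porbit_mem
           -[in s i](expg1 s) porbit_perm subrr.
Qed.

(** If [x] precedes [y] on the cycle, the rank one term cancels the entry [-1] at [(x, y)], and
    listing indices along the cycle from [y] makes the matrix unitriangular. Any other [x] is
    reached by a factor of determinant 1. *)
Lemma det_1Bperm_cycle (R : comNzRingType) (m : nat) (s : 'S_m.+1) (x y : 'I_m.+1) :
  (forall z, z \in porbit s y) -> \det (1%:M - perm_mx s + delta_mx x y) = 1 :> R.
Proof.
move=> sy; pose x0 := s^-1%g y.
pose A0 : 'M[R]_m.+1 := 1%:M - perm_mx s + delta_mx x0 y.
have card_y : #|porbit s y| = m.+1.
  by rewrite -[RHS]card_ord; apply: eq_card => z; rewrite sy.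
have injf : injective (fun k : 'I_m.+1 => iter k s y).
  move=> i j; have := uniq_traject_porbit s y; rewrite card_y => uniq_t.
  rewrite -!(nth_traject s (n := m.+1)) // => /eqP.
  by rewrite nth_uniq ?size_traject // => /eqP/val_inj.
pose t := perm injf.
have detA0 : \det A0 = 1.
  have <- : \det (row_perm t (col_perm t A0)) = \det A0.
    rewrite row_permE col_permE !det_mulmx !det_perm odd_permV mulrCA.
    by rewrite -signr_addb addbb mulr1.
  have entry (i j : 'I_m.+1) : (j <= i)%N ->
      row_perm t (col_perm t A0) i j = (i == j)%:R.
    move=> le_ji; rewrite !mxE (inj_eq perm_inj) -(can2_eq (permK s) (permKV s)).
    have [-> |sti_y] := eqVneq (s (t i)) y; first by rewrite [t j == y]eq_sym subrK.
    suff /negbTE->: s (t i) != t j by rewrite subr0 addr0.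
    apply: contra sti_y; rewrite !permE /= -iterS => /eqP.
    move: (ltn_ord i); rewrite leq_eqVlt => /orP[/eqP im _|im].
      by rewrite im -[in X in iter X]card_y iter_porbit.
    rewrite -[i.+1]/(nat_of_ord (Ordinal im)) => /injf/(congr1 val)/= ij.
    by rewrite -ij ltnn in le_ji.
  rewrite -det_tr det_trig.
    by rewrite big1 // => i _; rewrite mxE entry ?eqxx.
  apply/is_trig_mxP => i j lt_ij; rewrite mxE entry ?(ltnW lt_ij) //.
  by rewrite -val_eqE gtn_eqF.
(* The columns of [A0] add up to [e_y^T], so left multiplication by [1 - c 1^T] moves the rank one
   term from row [x0] to row [x]. The determinant of this factor is 1 because the entries of [c] sum
   to 0. *)
pose c : 'cV[R]_m.+1 := delta_mx x0 0 - delta_mx x 0.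
have sumA0 : const_mx 1 *m A0 = delta_mx 0 y :> 'rV_m.+1.
  apply/rowP => j; rewrite !mxE eqxx /=.
  rewrite (eq_bigr (fun k => (k == j)%:R - (s k == j)%:R
                             + ((k == x0) && (j == y))%:R)); last first.
    by move=> k _; rewrite !mxE mul1r.
  have sum1 (k0 : 'I_m.+1) (b : bool) :
      \sum_(k < m.+1) ((k == k0) && b)%:R = b%:R :> R.
    rewrite (bigD1 k0) //= eqxx big1 ?addr0 // => k /negbTE -> //.
  rewrite big_split sumrB /= sum1.
  have -> : \sum_k (s k == j)%:R = \sum_k (k == j)%:R :> R.
    by rewrite [RHS](reindex_inj (@perm_inj _ s)).
  by rewrite subrr add0r.
have -> : 1%:M - perm_mx s + delta_mx x y = (1%:M - c *m const_mx 1) *m A0.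
  rewrite mulmxBl mul1mx -mulmxA sumA0 mulmxBl !mul_delta_mx /A0.
  by rewrite opprB -[RHS]addrA subrKC.
rewrite det_mulmx detA0 mulr1 det_1Bmulmx_comm det_mx11 !mxE.
rewrite (eq_bigr (fun k => (k == x0)%:R - (k == x)%:R)); last first.
  by move=> k _; rewrite !mxE mul1r eqxx !andbT.
have sum1 (k0 : 'I_m.+1) : \sum_(k < m.+1) (k == k0)%:R = 1 :> R.
  by rewrite (bigD1 k0) //= eqxx big1 ?addr0 // => k /negbTE ->.
by rewrite sumrB !sum1 subrr subr0.
Qed.

(** * Difference operators on the circle and the matrices attached to chords *)

Section Circle.
Variable m : nat.

Definition pred_perm : 'S_m.+1 := perm (can_inj (@ord_predK m.+1)).

Lemma ord_pred_val (k : 'I_m.+1) :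
  ord_pred k = (if k == 0 :> nat then m else k.-1) :> nat.
Proof.
move: (ltn_ord k) => ltk /=; case: eqP => [->|/eqP k0].
  by rewrite add0n modn_small.
by rewrite addnS /= -{1}(prednK (n := k)) ?lt0n // addSnnS modnDr
  modn_small // prednK ?lt0n // ltnW.
Qed.

Lemma pred_perm_cycle (z : 'I_m.+1) : z \in porbit pred_perm ord_max.
Proof.
have predX d : (d <= m)%N -> (pred_perm ^+ d)%g ord_max = (m - d)%N :> nat.
  elim: d => [|d IHd] le_dm; first by rewrite expg0 perm1 subn0.
  rewrite expgSr permM permE ord_pred_val IHd ?(ltnW le_dm) //.
  by case: eqP; lia.
apply/porbitP; exists (m - z)%N; apply/val_inj; rewrite /= predX ?leq_subr //.
by rewrite subKn // -ltnS.
Qed.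

Lemma odd_cycle (s : 'S_m.+1) y : (forall z, z \in porbit s y) -> odd_perm s = odd m.
Proof.
move=> sy; rewrite /odd_perm card_ord.
suff -> : porbits s = [set porbit s y] by rewrite cards1 /= addbT negbK.
apply/setP => X; rewrite inE; apply/imsetP/eqP => [[z _ ->]|->]; last by exists y.
by apply/eqP; rewrite eq_porbit_mem sy.
Qed.

Variable R : comNzRingType.

Definition diff_mx : 'M[R]_m.+1 := 1%:M - perm_mx pred_perm.
Definition cut_mx : 'M[R]_m.+1 := diff_mx + delta_mx ord0 ord_max.
Definition cum_mx : 'M[R]_m.+1 := \matrix_(k, j) (j <= k)%:R.

(** Going around the circle, the step function at [u] rises at [u] and falls back at position 0. *)
Lemma leq_diff (u k : 'I_m.+1) :
  (u <= k)%:R - (u <= ord_pred k)%:R = (u == k)%:R - (k == 0 :> nat)%:R :> R.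
Proof.
rewrite ord_pred_val -(inj_eq val_inj) /=; have := leq_ord u; have := leq_ord k.
move: (val u) (val k) => {}u {}k km um.
case: (k =P 0%N) => [->|k0]; first by rewrite leqn0 um.
rewrite subr0; case: (ltngtP u k) => [uk|uk|->].
- by rewrite (_ : (u <= k.-1)%N) ?subrr //; lia.
- by rewrite (_ : (u <= k.-1)%N = false) ?subrr //; lia.
- by rewrite (_ : (k <= k.-1)%N = false) ?subr0 //; lia.
Qed.

Lemma cut_cum_mx : cut_mx *m cum_mx = 1%:M.
Proof.
apply/matrixP => i j; rewrite !mxE.
rewrite (eq_bigr (fun k => (k == i)%:R * (j <= k)%:R
   - (k == ord_pred i)%:R * (j <= k)%:R
   + (k == ord_max)%:R * ((i == ord0)%:R * (j <= k)%:R))); last first.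
  move=> k _; rewrite !mxE permE mulrDl mulrBl (eq_sym i) (eq_sym (ord_pred i)).
  by case: (k == ord_max); rewrite ?andbT ?andbF ?mul1r ?mul0r.
rewrite big_split sumrB /= !sum_pred1_mul leq_diff -ltnS ltn_ord mulr1.
by rewrite subrK eq_sym.
Qed.

Lemma det_cut_mx : \det cut_mx = 1.
Proof. exact: (det_1Bperm_cycle _ _ pred_perm_cycle). Qed.

Lemma diff_mx_mul (v : 'I_m.+1 -> R) k :
  \sum_j diff_mx k j * v j = v k - v (ord_pred k).
Proof.
rewrite (eq_bigr (fun j => (j == k)%:R * v j - (j == ord_pred k)%:R * v j)).
  by rewrite sumrB !sum_pred1_mul.
by move=> j _; rewrite !mxE permE mulrBl (eq_sym k) (eq_sym (ord_pred k)).
Qed.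

Lemma cut_mx_mul (v : 'I_m.+1 -> R) k :
  \sum_j cut_mx k j * v j = v k - v (ord_pred k) + (k == ord0)%:R * v ord_max.
Proof.
rewrite -diff_mx_mul.
rewrite (eq_bigr (fun j => diff_mx k j * v j
   + (j == ord_max)%:R * ((k == ord0)%:R * v j))).
  by rewrite big_split /= !sum_pred1_mul.
move=> j _; rewrite /cut_mx mxE mulrDl; congr (_ + _); rewrite mxE.
by case: (j == ord_max); rewrite ?andbT ?andbF ?mul1r ?mul0r.
Qed.

Variables (n : nat) (p : 'I_n * bool -> 'I_m.+1) (q : 'I_m.+1 -> 'I_n * bool).
Hypotheses (pK : cancel p q) (qK : cancel q p).
Variable o : 'I_n -> bool.

Definition chord_mx : 'M[R]_(m.+1, n) :=
  \matrix_(k, i) ((k == p (i, o i))%:R - (k == p (i, ~~ o i))%:R).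

(** The discrete primitive of column [j] of [chord_mx]: up to sign, the indicator of the arc between
    the two ends that avoids the cut. *)
Definition chord_val (j : 'I_n) (k : 'I_m.+1) : R :=
  (p (j, o j) <= k)%:R - (p (j, ~~ o j) <= k)%:R.

Definition chord_form_mx (tau : 'I_n -> bool) : 'M[R]_n :=
  \matrix_(i, j) (if i == j then (tau i)%:R
                  else chord_val j (p (i, ~~ o i)) - chord_val j (p (i, o i))).

Definition side_mx (tau : 'I_n -> bool) (F : {set 'I_n}) : 'M[R]_(n, m.+1) :=
  \matrix_(i, k) (if i \in F then chord_mx k i + (tau i)%:R * diff_mx (p (i, ~~ o i)) k
                  else 0).

Definition boundary_mx tau F := cut_mx - chord_mx *m side_mx tau F.

Lemma chord_mxE k i :
  chord_mx k i = if i == (q k).1 then (-1) ^+ ((q k).2 (+) o i) else 0.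
Proof.
rewrite mxE -!(can2_eq qK pK); case: (q k) => i' c /=.
rewrite !xpair_eqE (eq_sym i); case: eqP => //= [_|_]; last by rewrite subrr.
by case: c (o i) => [] []; rewrite ?subr0 ?sub0r.
Qed.

Lemma chord_mx_mul (v : 'I_m.+1 -> R) i :
  \sum_k chord_mx k i * v k = v (p (i, o i)) - v (p (i, ~~ o i)).
Proof.
by under eq_bigr do rewrite mxE mulrBl; rewrite sumrB !sum_pred1_mul.
Qed.

Lemma cum_chord_mx : cum_mx *m chord_mx = \matrix_(k, j) chord_val j k.
Proof.
apply/matrixP => k j; rewrite !mxE.
under eq_bigr do rewrite mulrC.
by rewrite chord_mx_mul !mxE.
Qed.

Lemma det_boundary_mx tau F :
  \det (boundary_mx tau F) = \det (principal_mx F (chord_form_mx tau)).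
Proof.
have -> : boundary_mx tau F =
          cut_mx *m (1%:M - (cum_mx *m chord_mx) *m side_mx tau F).
  by rewrite mulmxBr mulmx1 !mulmxA cut_cum_mx mul1mx.
rewrite det_mulmx det_cut_mx mul1r det_1Bmulmx_comm; congr (\det _).
apply/matrixP => i j; rewrite cum_chord_mx !mxE.
case: ifP => iF; last first.
  by rewrite big1 ?subr0 // => k _; rewrite mxE iF mul0r.
rewrite (eq_bigr (fun k => chord_mx k i * chord_val j k
    + (tau i)%:R * (diff_mx (p (i, ~~ o i)) k * chord_val j k))); last first.
  by move=> k _; rewrite mxE iF mulrDl mulrA [(\matrix_(_, _) chord_val _ _) _ _]mxE.
rewrite big_split /= -big_distrr /= chord_mx_mul diff_mx_mul.
(* The primitive of chord [j] jumps at [b_i] only if [i = j], where it drops by 1. This is what puts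
   [tau i] on the diagonal. *)
have -> : chord_val j (p (i, ~~ o i)) - chord_val j (ord_pred (p (i, ~~ o i)))
    = - (i == j)%:R.
  transitivity (chord_mx (p (i, ~~ o i)) j).
    set b := p (i, ~~ o i); rewrite mxE -/b /chord_val !(eq_sym b).
    have := leq_diff (p (j, ~~ o j)) b; have := leq_diff (p (j, o j)) b.
    by move=> /eqP; rewrite subr_eq => /eqP -> /eqP; rewrite subr_eq => /eqP ->; ring.
  rewrite chord_mxE pK /= (eq_sym j); case: eqP => [->|]; rewrite ?oppr0 //.
  by case: (o j); rewrite expr1.
case: eqP => [<-|_]; last by rewrite oppr0 mulr0 addr0 sub0r opprB.
rewrite /chord_val !leqnn.
have : p (i, o i) != p (i, ~~ o i).
  by rewrite (can_eq pK) xpair_eqE eqxx; case: (o i).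
rewrite -(inj_eq val_inj) /=; case: ltngtP => // _ _ /=; ring.
Qed.

Lemma boundary_mx_mul tau F (v : 'I_m.+1 -> R) k (i := (q k).1) :
  \sum_j boundary_mx tau F k j * v j
  = v k - v (ord_pred k) + (k == ord0)%:R * v ord_max
    - (i \in F)%:R * (-1) ^+ ((q k).2 (+) o i)
      * (v (p (i, o i)) - v (p (i, ~~ o i))
         + (tau i)%:R * (v (p (i, ~~ o i)) - v (ord_pred (p (i, ~~ o i))))).
Proof.
rewrite -cut_mx_mul -chord_mx_mul -diff_mx_mul.
have bE j : boundary_mx tau F k j = cut_mx k j
    - (-1) ^+ ((q k).2 (+) o i) * side_mx tau F i j.
  rewrite /boundary_mx mxE [X in _ + X]mxE [X in _ - X]mxE; congr (_ - _).
  rewrite (bigD1 i) //= chord_mxE eqxx big1 ?addr0 // => i' /negbTE ni'.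
  by rewrite chord_mxE ni' mul0r.
rewrite (eq_bigr (fun j => cut_mx k j * v j - (i \in F)%:R * (-1) ^+ ((q k).2 (+) o i)
   * (chord_mx j i * v j + (tau i)%:R * (diff_mx (p (i, ~~ o i)) j * v j)))).
  by rewrite sumrB -big_distrr big_split -big_distrr.
move=> j _; rewrite bE mulrBl [side_mx _ _ _ _]mxE; congr (_ - _).
case: (i \in F); rewrite ?mul0r ?mulr0 ?mul0r // mul1r -mulrA.
by congr (_ * _); rewrite mulrDl mulrA.
Qed.

(** The columns of [chord_mx] and of [diff_mx] sum to 0, so only the cut entry survives. Hence a
    kernel vector must vanish at [ord_max]. *)
Lemma colsum_boundary_mx tau F j :
  \sum_k boundary_mx tau F k j = (j == ord_max)%:R.
Proof.
have sum1 k0 : \sum_(k < m.+1) (k == k0)%:R = 1 :> R.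
  by under eq_bigr do rewrite -[_%:R]mulr1; rewrite sum_pred1_mul.
under eq_bigr do rewrite /boundary_mx mxE [X in _ + X]mxE [X in _ - X]mxE.
rewrite sumrB exchange_big /= [X in _ - X]big1 ?subr0; last first.
  move=> i _; rewrite -big_distrl /=; under eq_bigr do rewrite mxE.
  by rewrite sumrB !sum1 subrr mul0r.
rewrite (eq_bigr (fun k => (k == j)%:R - (pred_perm k == j)%:R
    + (k == ord0)%:R * (j == ord_max)%:R)); last first.
  by move=> k _; rewrite !mxE -mulnb natrM.
rewrite big_split /= sum_pred1_mul sumrB.
rewrite -(reindex_inj (@perm_inj _ pred_perm) (P := predT) (F := fun k => (k == j)%:R)).
by rewrite subrr add0r.
Qed.

Definition flip (F : {set 'I_n}) (k : 'I_m.+1) : 'I_m.+1 :=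
  p ((q k).1, (q k).2 (+) ((q k).1 \in F)).

Lemma flipK F : involutive (flip F).
Proof.
by move=> k; rewrite /flip pK /= -addbA addbb addbF -surjective_pairing qK.
Qed.

Definition flip_perm F : 'S_m.+1 := perm (can_inj (flipK F)).

(** Flipping [e] as well costs one transposition. *)
Lemma flip_permD1 (F : {set 'I_n}) e : e \in F ->
  flip_perm F = ~~ flip_perm (F :\ e) :> bool.
Proof.
move=> eF.
have -> : flip_perm F = (tperm (p (e, false)) (p (e, true)) * flip_perm (F :\ e))%g.
  apply/permP => k; rewrite permM [LHS]permE [RHS]permE /flip.
  rewrite -[k]qK; case: (q k) => i c; rewrite !pK /=; case: (eqVneq i e) => [->|ie].
    by case: c; rewrite ?tpermL ?tpermR pK /= !inE eqxx eF.
  rewrite tpermD ?(can_eq pK) ?xpair_eqE 1?eq_sym ?(negbTE ie) //.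
  by rewrite pK /= !inE ie.
by rewrite odd_mul_tperm (can_eq pK) xpair_eqE eqxx.
Qed.

(** Subtracting [w_i w_i^T] from the identity exchanges the two ends of chord [i]. *)
Lemma boundary_mx0E F :
  boundary_mx (fun=> false) F
  = perm_mx (flip_perm F) - perm_mx pred_perm + delta_mx ord0 ord_max.
Proof.
apply/matrixP => k j.
have := boundary_mx_mul (fun=> false) F (fun j' => (j' == j)%:R) k.
rewrite (eq_bigr (fun j' => (j' == j)%:R * boundary_mx (fun=> false) F k j')).
  rewrite sum_pred1_mul => ->; rewrite mul0r addr0 !mxE !permE /flip.
  rewrite -natrM mulnb (eq_sym ord_max).
  rewrite -{1}(qK k); case: (q k) => i c /=.
  case: (i \in F); rewrite ?mul0r ?subr0 ?addbF // mul1r.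
  by case: c (o i) => [] [] /=; rewrite ?expr0 ?expr1; ring.
by move=> j' _; rewrite mulrC.
Qed.
End Circle.

Lemma det_untwisted (m n : nat) (R : idomainType) p q
    (pK : cancel p q) (qK : cancel q p) (o : 'I_n -> bool) (F : {set 'I_n})
    (d := \det (@boundary_mx m R n p o (fun=> false) F)) :
  d = 0 \/ d = 1 /\ odd_perm (flip_perm pK qK F) = false.
Proof.
pose t := flip_perm pK qK F.
have -> : d = \det (perm_mx t *m
   (1%:M - perm_mx (t^-1 * pred_perm m)%g + delta_mx (t ord0) ord_max)).
  rewrite /d (boundary_mx0E R pK qK); congr (\det _).
  rewrite mulmxDr mulmxBr mulmx1 -perm_mxM mulKVg; congr (_ + _).
  by rewrite -row_permE; apply/matrixP => i j; rewrite !mxE (inj_eq perm_inj).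
rewrite det_mulmx.
case: (boolP [forall z, z \in porbit (t^-1 * pred_perm m)%g ord_max]).
  (* A single cycle has the parity of [pred_perm], which forces [t] to be even; the sign of
     [perm_mx t] is then 1. *)
  move=> /forallP cyc; right.
  have := odd_cycle cyc; rewrite odd_permM odd_permV (odd_cycle (@pred_perm_cycle m)).
  rewrite -/t det_1Bperm_cycle // det_perm; case: (odd_perm t) => //=.
    by case: (odd m).
  by rewrite mulr1.
by case/forallPn => z zN; left; rewrite (det_1Bperm_notin _ _ zN) mulr0.
Qed.

(** * Connectedness of the boundary, read from the determinant modulo 2 *)

Lemma n_comp_eq1P (T : finType) (e : rel T) (x0 : T) : connect_sym e ->
  reflect (forall x, connect e x x0) (n_comp e predT == 1%N).
Proof.
move=> sym_e; apply: (iffP eqP) => [n1 x | conn]; last first.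
  rewrite -(n_comp_connect sym_e x0); apply: eq_n_comp_r => x.
  by rewrite -[RHS]topredE /= sym_e conn.
have /card_le1_eqP root1 : (n_comp e predT <= 1)%N by rewrite n1.
rewrite -(root_connect sym_e); apply/eqP/root1.
  by rewrite !inE roots_root.
by rewrite !inE roots_root.
Qed.

Section Boundary.
Variables (V : finType) (n m : nat) (B : ribbon_graph V 'I_n).
Variables (p : 'I_n * bool -> 'I_m.+1) (q : 'I_m.+1 -> 'I_n * bool).
Hypotheses (pK : cancel p q) (qK : cancel q p).
Hypothesis p_rot : forall h, p (Defs.rot B h) = ordS (p h).
Variables (o : 'I_n -> bool) (F : {set 'I_n}).

Let p_rotV h : p ((Defs.rot B)^-1%g h) = ord_pred (p h).
Proof. by apply: (can_inj (@ordSK _)); rewrite ord_predK -p_rot permKV. Qed.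

Local Notation adj := (boundary_adj B F).
Local Notation M := (boundary_mx 'F_2 p o (twist B) F).

(** Gap [k] is the vertex arc that follows the half-edge at position [k]; a flag [(h, false)] lies
    on the gap before [h]. *)
Definition gap_val (v : 'I_m.+1 -> 'F_2) (x : flag 'I_n) : 'F_2 :=
  if x.2 then v (p x.1) else v (ord_pred (p x.1)).

Lemma gap_val_gap v x : gap_val v (across_gap B x) = gap_val v x.
Proof. by case: x => h [] /=; rewrite /gap_val /= ?p_rot ?ordSK ?p_rotV. Qed.

(** Every ribbon side of [(V, F)] contains [side_flag k] for exactly one [k]; the
    case of a twisted ribbon follows the rows of [boundary_mx] modulo 2. *)
Definition side_flag (k : 'I_m.+1) : flag 'I_n :=
  let h := q k in (h, [&& h.1 \in F, twist B h.1 & h.2 != o h.1]).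

(** Signs disappear modulo 2, which leaves a finite check over ['F_2]. *)
Lemma boundary_mx_gap_val v k :
  \sum_j M k j * v j =
  gap_val v (side_flag k) + gap_val v (across_edge B F (side_flag k))
  + (k == ord0)%:R * v ord_max.
Proof.
rewrite (boundary_mx_mul pK qK) /side_flag /gap_val -[k in v k]qK -[k in ord_pred k]qK.
case: (q k) => i c /=.
have F2 (x : 'F_2) : {x = 0} + {x = 1}.
  by case: x => [[|[|//]]] lt; [left | right]; apply: val_inj.
by case: (i \in F); case: (twist B i); case: c; case: (o i) => /=;
  move: (_ * v ord_max) (v (p (i, true))) (v (p (i, false)))
    (v (ord_pred (p (i, true)))) (v (ord_pred (p (i, false)))) => z a b a' b';
  case: (F2 z); case: (F2 a); case: (F2 b); case: (F2 a'); case: (F2 b') => *;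
  subst; apply/eqP.
Qed.

Lemma side_flagP x : exists k, x = side_flag k \/ x = across_edge B F (side_flag k).
Proof.
case: x => -[i c] s.
(* A side has two flags; when [x] is not the marked one and [i] is in [F], the marked one sits at
   the other end of the ribbon. *)
exists (if (i \in F) && ~~ (if twist B i then s (+) (c == o i) else ~~ s)
        then p (i, ~~ c) else p (i, c)).
rewrite /side_flag /=.
case: (boolP (i \in F)) => iF /=; last first.
  by rewrite pK /= (negbTE iF); case: s; [right | left].
by case tw: (twist B i); case oi: (o i); case: s c => [] [] /=;
  rewrite pK /= iF tw ?oi /=; auto.
Qed.

Lemma det_boundary_mx_F2 : (\det M != 0) = (n_comp adj predT == 1%N).
Proof.
have sym_adj : connect_sym adj by apply/sym_connect_sym/boundary_adj_sym.
pose x0 : flag 'I_n := (q ord_max, true).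
apply/idP/(n_comp_eq1P x0 sym_adj) => [detM y | conn].
  apply: contraNT detM => yN; apply/eqP.
  (* The component of [y] misses [x0], so its indicator vanishes at [ord_max]. The correction term
     is then 0 and the indicator lies in the kernel. *)
  pose v k : 'F_2 := (connect adj (q k, true) y)%:R.
  have vE x : gap_val v x = (connect adj x y)%:R.
    have vtrue h : gap_val v (h, true) = (connect adj (h, true) y)%:R.
      by rewrite /gap_val /= /v pK.
    case: x => h [] //; rewrite -gap_val_gap vtrue; congr (nat_of_bool _)%:R.
    apply/esym/(same_connect sym_adj)/connect1.
    by rewrite /boundary_adj /= eqxx.
  have [k vk] : exists k, v k != 0.
    have : gap_val v y != 0 by rewrite vE connect0 oner_neq0.
    by rewrite /gap_val; case: y.2 => ?; [exists (p y.1) | exists (ord_pred (p y.1))].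
  apply: (det_eq0_ker vk) => i; rewrite boundary_mx_gap_val !vE.
  rewrite /v -/x0 (sym_adj x0) (negbTE yN) mulr0 addr0.
  have -> : connect adj (side_flag i) y
            = connect adj (across_edge B F (side_flag i)) y.
    by apply/(same_connect sym_adj)/connect1; rewrite /boundary_adj /= eqxx orbT.
  by rewrite (addrr_pchar2 (pchar_Fp _)).
apply/negP; rewrite -det_tr => /det0P[w w0 wM].
pose v k := w 0 k.
have Mv k : \sum_j M k j * v j = 0.
  have -> : \sum_j M k j * v j = (w *m M^T) 0 k.
    by rewrite mxE; apply: eq_bigr => j _; rewrite [_^T _ _]mxE mulrC.
  by rewrite wM mxE.
have vmax : v ord_max = 0.
  have : \sum_k \sum_j M k j * v j = 0 by rewrite big1.
  rewrite exchange_big /=.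
  by under eq_bigr do rewrite -big_distrl /= colsum_boundary_mx; rewrite sum_pred1_mul.
(* With the correction term gone, each row equates the values at the two flags of a side. So [v] is
   constant along the connected boundary, hence 0. *)
have v_edge x : gap_val v (across_edge B F x) = gap_val v x.
  have side k : gap_val v (across_edge B F (side_flag k)) = gap_val v (side_flag k).
    have := Mv k; rewrite boundary_mx_gap_val vmax mulr0 addr0 => /eqP.
    by rewrite addr_eq0 (oppr_pchar2 (pchar_Fp _)) // => /eqP.
  by have [k [->|->]] := side_flagP x; rewrite ?across_edgeK side.
case/eqP: w0; apply/rowP => k; rewrite !mxE -/(v k).
have -> : v k = gap_val v (q k, true) by rewrite /gap_val /= qK.
suff -> : gap_val v (q k, true) = gap_val v x0 by rewrite /gap_val /= qK.
have /connectP[s] := conn (q k, true).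
elim: s (q k, true) => [|y s IHs] x /=; first by move=> _ ->.
by case/andP => /orP[]/eqP -> /IHs{}IHs /IHs <-; rewrite ?gap_val_gap ?v_edge.
Qed.
End Boundary.

(** * The intersection matrix in terms of positions on the circle *)

(** The number of steps from [a] to [x] around a circle of [N] points. *)
Definition cdist (N a x : nat) : nat :=
  if (a <= x)%N then (x - a)%N else (x + N - a)%N.

(** Here [a], [b] are the ends of one chord and [c], [d] those of another; the right side is the
    variation of the primitive of the second chord between the ends of the first. *)
Lemma cyclic_sign (N a b c d : nat) (dist := cdist N a) :
  (a < N)%N -> (b < N)%N -> (c < N)%N -> (d < N)%N ->
  a != b -> c != d -> a != c -> a != d -> b != c -> b != d ->
  (if [&& 0 < dist c, dist c < dist b & dist b < dist d]%N then 1
   else if [&& 0 < dist d, dist d < dist b & dist b < dist c]%N then -1 else 0)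
  = (c <= b)%:R - (d <= b)%:R - ((c <= a)%:R - (d <= a)%:R) :> int.
Proof.
move=> aN bN cN dN ab cd ac ad bc bd.
(* Distances from [a] compare like positions, unless exactly one of the two points lies beyond the
   cut. *)
have dist_lt x y : (x < N)%N -> (y < N)%N ->
    (dist x < dist y)%N = (if (a <= x)%N == (a <= y)%N then x < y else a <= x)%N.
  by move=> xN yN; rewrite /dist /cdist; case: (leqP a x); case: (leqP a y) => ? ? /=; lia.
have dist_gt0 x : (x < N)%N -> a != x -> (0 < dist x)%N.
  by move=> xN; rewrite /dist /cdist; case: (leqP a x); lia.
rewrite !dist_gt0 ?dist_lt {dist dist_lt dist_gt0 aN bN cN dN}//=.
move: ab cd ac ad bc bd.
case: (ltngtP a b) => // ab _ _; case: (ltngtP a c) => // ac _;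
  case: (ltngtP a d) => // ad _; case: (ltngtP b c) => // bc _;
  case: (ltngtP b d) => // bd _; exfalso; lia.
Qed.

Section Position.
Variables (V : finType) (n m : nat) (B : ribbon_graph V 'I_n).
Variables (p : 'I_n * bool -> 'I_m.+1) (q : 'I_m.+1 -> 'I_n * bool).
Hypotheses (pK : cancel p q) (qK : cancel q p).
Hypothesis p_rot : forall h, p (Defs.rot B h) = ordS (p h).
Variable o : 'I_n -> bool.
Local Notation r := (Defs.rot B).

Lemma cdist_lt a x N : (x < N)%N -> (a < N)%N -> (cdist N a x < N)%N.
Proof. by move=> xN aN; rewrite /cdist; case: (leqP a x); lia. Qed.

Lemma iter_cdist h k : k = iter (cdist m.+1 (p h) (p k)) r h.
Proof.
have p_iter d : p (iter d r h) = ((p h + d) %% m.+1)%N :> nat.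
  elim: d => [|d IHd]; first by rewrite addn0 modn_small.
  by rewrite iterS p_rot /= IHd -addn1 modnDml addn1 addnS.
apply/(can_inj pK)/val_inj; rewrite /= p_iter /cdist /=.
have := ltn_ord (p h); have := ltn_ord (p k); case: (leqP (p h) (p k)) => le ltk lth.
  by rewrite subnKC ?modn_small.
by rewrite subnKC ?modnDr ?modn_small //; lia.
Qed.

Lemma fconnect_rot h k : fconnect r h k.
Proof. by rewrite {1}(iter_cdist h k) fconnect_iter. Qed.

Lemma findex_cdist h k : findex r h k = cdist m.+1 (p h) (p k).
Proof.
rewrite {1}(iter_cdist h k) findex_iter //.
suff -> : fingraph.order r h = m.+1 by apply: cdist_lt.
rewrite -[RHS]card_ord -(bij_eq_card (Bijective pK qK)); apply: eq_card => x.
by rewrite !inE -[LHS]/(fconnect r h x) fconnect_rot.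
Qed.

Lemma cyclic_orderE x y z t : cyclic_order B x y z t =
  [&& 0 < cdist m.+1 (p x) (p y),
      cdist m.+1 (p x) (p y) < cdist m.+1 (p x) (p z)
    & cdist m.+1 (p x) (p z) < cdist m.+1 (p x) (p t)]%N.
Proof.
by rewrite /cyclic_order !fconnect_rot -!findex_cdist /= !andbT.
Qed.

Let pN h k : h != k -> p h != p k :> nat.
Proof. by move=> hk; rewrite (inj_eq val_inj) (can_eq pK). Qed.

Let pNchord i j b c : i != j -> p (i, b) != p (j, c) :> nat.
Proof. by move=> ij; rewrite pN // xpair_eqE (negbTE ij). Qed.

Let pNend i : p (i, o i) != p (i, ~~ o i) :> nat.
Proof. by rewrite pN // xpair_eqE eqxx; case: (o i). Qed.

Lemma chord_signE i j : i != j ->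
  chord_sign B o i j = chord_val int p o j (p (i, ~~ o i))
                       - chord_val int p o j (p (i, o i)).
Proof.
move=> ij; rewrite /chord_sign !cyclic_orderE.
by apply: cyclic_sign; rewrite ?ltn_ord ?pNend ?pNchord.
Qed.

(** Exchanging the two sides of a comparison of distinct positions turns its value [x] into [1 - x];
    the constants cancel. *)
Lemma chord_val_skew (R : comNzRingType) i j : i != j ->
  chord_val R p o i (p (j, ~~ o j)) - chord_val R p o i (p (j, o j)) =
  - (chord_val R p o j (p (i, ~~ o i)) - chord_val R p o j (p (i, o i))).
Proof.
move=> ij; have leC x y : x != y :> nat -> (x <= y)%:R = 1 - (y <= x)%:R :> R.
  by case: ltngtP; rewrite ?subr0 ?subrr.
rewrite /chord_val (leC (p (i, o i)) (p (j, o j))) ?pNchord //.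
rewrite (leC (p (i, o i)) (p (j, ~~ o j))) ?pNchord //.
rewrite (leC (p (i, ~~ o i)) (p (j, o j))) ?pNchord //.
rewrite (leC (p (i, ~~ o i)) (p (j, ~~ o j))) ?pNchord //.
ring.
Qed.

Lemma intersection_mxE : intersection_mx B o = chord_form_mx int p o (twist B).
Proof.
apply/matrixP => i j; rewrite !mxE; case: eqVneq => [_|ij].
  by rewrite /nonorientable_loop /loop attP fconnect_rot.
case: ltngtP => [lt|lt|/val_inj eq_ij]; last by move: ij; rewrite eq_ij eqxx.
  by rewrite chord_signE.
by rewrite chord_signE 1?eq_sym // chord_val_skew ?opprK // eq_sym.
Qed.
End Position.

(** * Principal minors with one twisted loop, and the final count *)

(** Linearity in row [e]: the added unit row is the row that [principal_mx] has at [e] once [e]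
    leaves the set. *)
Lemma det_principal_pred1 (R : comNzRingType) (n : nat) (A : 'M[R]_n) e
    (F : {set 'I_n}) : e \in F ->
  \det (principal_mx F (A + delta_mx e e)) =
  \det (principal_mx F A) + \det (principal_mx (F :\ e) A).
Proof.
move=> eF; rewrite -[RHS]mul1r mulrDr.
apply: (determinant_multilinear (i0 := e)); apply/matrixP => i j; rewrite !mxE.
- by rewrite eF !inE !eqxx !mul1r (eq_sym j).
- by rewrite (eq_sym (lift e i) e) (negbTE (neq_lift _ _)) addr0.
- by rewrite !inE (eq_sym (lift e i) e) (negbTE (neq_lift _ _)) addr0.
Qed.

Lemma bouquet_vertex_eq (V : finType) (n : nat) (B : ribbon_graph V 'I_n) :
  bouquet B -> forall u v : V, u = v.
Proof.
move=> hB u v; have /card_le1_eqP eqV : (#|V| <= 1)%N by rewrite (eqP hB).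
exact: eqV.
Qed.

(** With one vertex, [rot] is a single cycle, and half-edges are numbered by their number of
    rotations from [x0]. *)
Lemma bouquet_half_edge_numbering (V : finType) (n : nat) (B : ribbon_graph V 'I_n)
    (x0 : 'I_n * bool) :
  bouquet B ->
  exists m (p : 'I_n * bool -> 'I_m.+1) (q : 'I_m.+1 -> 'I_n * bool),
    [/\ cancel p q, cancel q p & forall h, p (Defs.rot B h) = ordS (p h)].
Proof.
move=> hB; set r := Defs.rot B.
have conn h k : fconnect r h k by rewrite -attP; apply/eqP/(bouquet_vertex_eq hB).
pose m := (fingraph.order r x0).-1.
have mE : fingraph.order r x0 = m.+1 by rewrite prednK // order_gt0.
pose p h : 'I_m.+1 := inord (findex r x0 h).
pose q (k : 'I_m.+1) := iter k r x0.
have pE h : p h = findex r x0 h :> nat by rewrite inordK // -mE findex_max.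
have pK : cancel p q by move=> h; rewrite /q pE iter_findex.
have qK : cancel q p.
  by move=> k; apply: val_inj; rewrite /= pE findex_iter // mE.
exists m, p, q; split=> // h; apply: (can_inj qK); rewrite pK -{1}(pK h) /q /= -iterS.
have := ltn_ord (p h); rewrite leq_eqVlt => /orP[/eqP -> | lt].
  by rewrite modnn -mE iter_order //; apply: perm_inj.
by rewrite modn_small.
Qed.

Lemma chord_form_mx_pred1 (R : comNzRingType) (n m : nat) (p : 'I_n * bool -> 'I_m.+1)
    o (tau : 'I_n -> bool) e : tau =1 pred1 e ->
  chord_form_mx R p o tau = chord_form_mx R p o (fun=> false) + delta_mx e e.
Proof.
move=> tauE; apply/matrixP => i j; rewrite !mxE tauE /=.
case: (eqVneq i j) => [<-|ij]; first by rewrite andbb add0r.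
case: (eqVneq i e) => [ie|_]; last by rewrite addr0.
by rewrite -ie eq_sym (negbTE ij) addr0.
Qed.

Lemma principal_mxD_notin (R : comNzRingType) (n : nat) (A : 'M[R]_n) e
    (F : {set 'I_n}) :
  e \notin F -> principal_mx F (A + delta_mx e e) = principal_mx F A.
Proof.
move=> eF; apply/matrixP => i j; rewrite !mxE; case: ifP => // iF.
suff /negbTE-> : i != e by rewrite addr0.
by apply: contraNneq eF => <-.
Qed.

Lemma det_one_twist (n m : nat) (R : idomainType)
    (p : 'I_n * bool -> 'I_m.+1) (q : 'I_m.+1 -> 'I_n * bool)
    (pK : cancel p q) (qK : cancel q p) o (tau : 'I_n -> bool) e (F : {set 'I_n})
    (d := \det (principal_mx F (chord_form_mx R p o tau))) :
  tau =1 pred1 e -> d = 0 \/ d = 1.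
Proof.
move=> tauE; rewrite /d (chord_form_mx_pred1 _ _ _ tauE).
have det01 := det_untwisted R pK qK o.
case: (boolP (e \in F)) => eF; last first.
  by rewrite principal_mxD_notin // -(det_boundary_mx R pK qK); case: (det01 F); tauto.
rewrite det_principal_pred1 // -!(det_boundary_mx R pK qK).
(* Both minors equal to 1 would make both flips even, although they differ by a transposition. *)
have := flip_permD1 pK qK eF.
by case: (det01 F) => [->|[-> ->]]; case: (det01 (F :\ e)) => [->|[-> ->]] //;
  rewrite ?addr0 ?add0r; auto.
Qed.

Lemma map_principal_chord_form_mx (n m : nat) (R : comNzRingType)
    (p : 'I_n * bool -> 'I_m.+1) o tau (F : {set 'I_n}) :
  map_mx intr (principal_mx F (chord_form_mx int p o tau))
  = principal_mx F (chord_form_mx R p o tau).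
Proof.
apply/matrixP => i j; rewrite !mxE.
case: ifP => _; last by rewrite rmorph_nat.
by case: ifP => _; rewrite ?rmorphB /= ?rmorph_nat.
Qed.

Theorem theorem4p3 (V : finType) (n : nat) (B : ribbon_graph V 'I_n)
    (hB : bouquet B)
    (h1 : #|[set e : 'I_n | nonorientable_loop B e]| = 1%N)
    (o : 'I_n -> bool) :
  (kappa B)%:Z = \det (1%:M + intersection_mx B o).
Proof.
have [e /setP twe] : exists e, [set e | nonorientable_loop B e] = [set e].
  by apply/cards1P; rewrite h1.
have {twe} twe : twist B =1 pred1 e.
  move=> i; have := twe i; rewrite !inE /nonorientable_loop /loop => <-.
  by rewrite (bouquet_vertex_eq hB (att B (i, false)) (att B (i, true))) eqxx.
have [m [p [q [pK qK p_rot]]]] := bouquet_half_edge_numbering (e, false) hB.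
rewrite (intersection_mxE pK qK p_rot) det_1Dmx /kappa -sum1dep_card.
rewrite -natz natr_sum big_mkcond; apply: eq_bigr => F _.
have -> : spanning_quasi_tree B F = (n_comp (boundary_adj B F) predT == 1%N).
  (* The only vertex carries [e], so no vertex is isolated. *)
  rewrite /spanning_quasi_tree /nb_boundary [X in (_ + X)%N]eq_card0 ?addn0 // => v.
  rewrite !inE; apply/negbTE; rewrite negbK.
  by apply/codomP; exists (e, false); apply: (bouquet_vertex_eq hB).
rewrite -(det_boundary_mx_F2 pK qK p_rot o) (det_boundary_mx _ pK qK).
(* The minor over ['F_2] is the reduction of the integer one, and an integer in {0, 1} is determined
   by its parity. *)
rewrite -map_principal_chord_form_mx det_map_mx.
by case: (det_one_twist int pK qK o F twe) => ->;
  rewrite ?rmorph0 ?rmorph1 ?eqxx ?oner_eq0.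
Qed.
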